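(* Let $\mathcal{D}=\{0,1\}$, let $\tilde u$ be a counterfactual utility and let $\tilde u^{\mathrm{Ext}}$ be a chosen extension of it to mean outcomes. Suppose that the following assumptions hold. (Bounded Means) There exist $L<U$ such that the mean outcomes satisfy $p_d\in I:=[L,U]$ for $d\in\{0,1\}$. (Decision Monotonicity) For every fixed $p_0\in I$, the map $p_1\mapsto\Gamma\tilde u^{\mathrm{Ext}}(p_0,p_1)$ is non-decreasing on $I$; and for every fixed $p_1\in I$, the map $p_0\mapsto\Gamma\tilde u^{\mathrm{Ext}}(p_0,p_1)$ is non-increasing on $I$. (Unique Crossing) For every fixed $p_0\in I$: (a) the map $p_1\mapsto\Gamma\tilde u^{\mathrm{Ext}}(p_0,p_1)$ has at most one root in $I$; (b) if there exist $\underline{p}_1<\overline{p}_1$ in $I$ with $\Gamma\tilde u^{\mathrm{Ext}}(p_0,\underline{p}_1)<0$ and $\Gamma\tilde u^{\mathrm{Ext}}(p_0,\overline{p}_1)>0$, then there exists $\tau(p_0)\in(\underline{p}_1,\overline{p}_1)$ with $\Gamma\tilde u^{\mathrm{Ext}}(p_0,\tau(p_0))=0$. Then there exists an extended standard utility of the form $u^{\mathrm{Ext}}(d;p_d)=\phi_d(p_d)$, with functions $\phi_0,\phi_1:I\to\mathbb{R}$, that induces the same optimal decision as $\tilde u^{\mathrm{Ext}}$; that is, for all $(p_0,p_1)\in I^2$, $$\Gamma\tilde u^{\mathrm{Ext}}(p_0,p_1)>0\iff\Gamma u^{\mathrm{Ext}}(p_0,p_1)>0,\qquad \Gamma\tilde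 u^{\mathrm{Ext}}(p_0,p_1)=0\iff\Gamma u^{\mathrm{Ext}}(p_0,p_1)=0,$$ where $\Gamma u^{\mathrm{Ext}}(p_0,p_1)=\phi_1(p_1)-\phi_0(p_0)$. Moreover, one may choose $\phi_1$ to be the identity, $\phi_1(p)=p$, and $\phi_0$ to be non-decreasing.
   Context: Outcomes take values in a set $\mathcal{Y}\subseteq\mathbb{R}$ and each decision $d\in\{0,1\}$ has a potential outcome $Y(d)$ with mean $p_d=\mathbb{E}[Y(d)]$ under the state of nature (a joint distribution of $(Y(0),Y(1))$). A counterfactual utility is a function $\tilde u:\{0,1\}\times\mathcal{Y}^2\to\mathbb{R}$, $(d,y_0,y_1)\mapsto\tilde u(d;y_0,y_1)$. An extension $\tilde u^{\mathrm{Ext}}$ of $\tilde u$ is a real-valued function $(d,p_0,p_1)\mapsto\tilde u^{\mathrm{Ext}}(d;p_0,p_1)$ accepting arbitrary real mean values $(p_0,p_1)\in I^2$ as arguments and agreeing with $\tilde u$ at pairs of outcomes $(y_0,y_1)\in\mathcal{Y}^2$ in its domain; no other relation between $\tilde u$ and $\tilde u^{\mathrm{Ext}}$ is assumed. Decisions are evaluated by plugging the means $(p_0,p_1)$ into the extended utility, and the contrast is $$\Gamma\tilde u^{\mathrm{Ext}}(p_0,p_1):=\tilde u^{\mathrm{Ext}}(1;p_0,p_1)-\tilde u^{\mathrm{Ext}}(0;p_0,p_1).$$ Decision $1$ is recommended if the contrast is positive, decision $0$ if it is negative, and there is indifference if it is zero. An extended standard utility is one in which the value of decision $d$ depends on $(p_0,p_1)$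 only through $p_d$. *)

(* Defs.v *)
From HB Require Import structures.
From mathcomp Require Import all_boot all_order all_algebra.
From mathcomp Require Import all_classical all_reals all_analysis.

Set Implicit Arguments.
Unset Strict Implicit.
Unset Printing Implicit Defensive.

Import Order.TTheory GRing.Theory Num.Theory.

Local Open Scope ring_scope.

(* Decisions are booleans: [false] is decision 0 and [true] is decision 1.
   A utility [u d y0 y1] is a total function on the reals; every statement
   below only looks at its values on the intended domain, which is Y x Y for a
   counterfactual utility and I x I, with I = [L, U], for an extension. *)
Definition utility (R : realType) := bool -> R -> R -> R.

(* The component of the pair (x0, x1) that belongs to decision d. *)
Definition component (R : realType) (d : bool) (x : R * R) : R :=
  if d then x.2 else x.1.

Definition joint_distribution (R : realType) :=
  probability (measurableTypeR R * measurableTypeR R)%type R.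

(* Joint distributions of (Y(0), Y(1)) with both potential outcomes in Y almost
   surely and with finite means. *)
Definition state_of_nature (R : realType) (Y : set R)
    (P : joint_distribution R) : Prop :=
  {ae P, forall y, Y y.1 /\ Y y.2} /\
  forall d : bool, P.-integrable setT (EFin \o @component R d).

Definition mean_outcome (R : realType) (P : joint_distribution R) (d : bool)
    : R :=
  fine ('E_P[@component R d])%E.

Definition bounded_means (R : realType) (L U : R)
    (states : set (joint_distribution R)) : Prop :=
  forall P, states P -> forall d, mean_outcome P d \in `[L, U].

Definition is_extension (R : realType) (Y : set R) (L U : R)
    (u uExt : utility R) : Prop :=
  forall d y0 y1, Y y0 -> Y y1 -> y0 \in `[L, U] -> y1 \in `[L, U] ->
    uExt d y0 y1 = u d y0 y1.

Definition contrast (R : realType) (u : utility R) (p0 p1 : R) : R :=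
  u true p0 p1 - u false p0 p1.

Definition decision_monotonicity (R : realType) (L U : R) (u : utility R)
    : Prop :=
  (forall p0, p0 \in `[L, U] ->
    {in `[L, U] &, {homo contrast u p0 : p1 q1 / p1 <= q1}}) /\
  (forall p1, p1 \in `[L, U] ->
    {in `[L, U] &, {homo contrast u ^~ p1 : p0 q0 /~ p0 <= q0}}).

Definition unique_crossing (R : realType) (L U : R) (u : utility R) : Prop :=
  forall p0, p0 \in `[L, U] ->
    (forall p1 q1, p1 \in `[L, U] -> q1 \in `[L, U] ->
       contrast u p0 p1 = 0 -> contrast u p0 q1 = 0 -> p1 = q1) /\
    (forall pl pu, pl \in `[L, U] -> pu \in `[L, U] -> pl < pu ->
       contrast u p0 pl < 0 -> 0 < contrast u p0 pu ->
       exists2 tau, tau \in `]pl, pu[ & contrast u p0 tau = 0).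

(* The utility u(d; p_d) = phi_d(p_d). *)
Definition standard_utility (R : realType) (phi : bool -> R -> R) : utility R :=
  fun d p0 p1 => phi d (component d (p0, p1)).

Definition same_optimal_decision (R : realType) (L U : R) (u v : utility R)
    : Prop :=
  forall p0 p1, p0 \in `[L, U] -> p1 \in `[L, U] ->
    (0 < contrast u p0 p1 <-> 0 < contrast v p0 p1) /\
    (contrast u p0 p1 = 0 <-> contrast v p0 p1 = 0).

(* Main.v *)
(* The sign of the contrast in p1, for p0 fixed, is that of p1 - phi0 p0, where
   phi0 p0 is the root of the contrast if there is one, L - 1 if the contrast is
   positive on all of I and U + 1 if it is negative on all of I.  A pair p0 <= q0
   with phi0 q0 < phi0 p0 would have a p1 in I with phi0 q0 <= p1 <= phi0 p0, so
   contrast p0 p1 <= 0 <= contrast q0 p1 <= contrast p0 p1, which forces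
   phi0 p0 = p1 = phi0 q0. *)
Require Import Defs.
From HB Require Import structures.
From mathcomp Require Import all_boot all_order all_algebra.
From mathcomp Require Import all_classical all_reals all_analysis.
From mathcomp Require Import lra.

Set Implicit Arguments.
Unset Strict Implicit.
Unset Printing Implicit Defensive.

Import Order.TTheory GRing.Theory Num.Theory.

Local Open Scope ring_scope.

(** At a root [t], monotonicity gives the weak sign of [f] on either side, and uniqueness of the
    root makes it strict. Without a root, the crossing hypothesis excludes a change of sign, so a
    threshold outside the interval does. *)
Lemma single_crossing_sg (R : realDomainType) (L U : R) (f : R -> R) :
  {in `[L, U] &, {homo f : x y / x <= y}} ->
  (forall x y, x \in `[L, U] -> y \in `[L, U] -> f x = 0 -> f y = 0 -> x = y) ->
  (forall x y, x \in `[L, U] -> y \in `[L, U] -> x < y -> f x < 0 -> 0 < f y ->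
     exists2 t, t \in `]x, y[ & f t = 0) ->
  exists2 t, [\/ t \in `[L, U], t = L - 1 | t = U + 1] &
    {in `[L, U], forall x, Num.sg (f x) = Num.sg (x - t)}.
Proof.
move=> f_homo f_root f_ivt.
have [[t tI ft0]|noroot] := pselect (exists2 t, t \in `[L, U] & f t = 0).
  exists t => [|x xI]; first exact: Or31.
  have [xt|tx|->] := ltgtP x t; last by rewrite ft0 subrr.
  - rewrite !ltr0_sg ?subr_lt0// lt_neqAle -{2}ft0 f_homo ?(ltW xt)// andbT.
    by apply/eqP => fx0; move: xt; rewrite (f_root _ _ xI tI fx0 ft0) ltxx.
  - rewrite !gtr0_sg ?subr_gt0// lt_neqAle -{2}ft0 f_homo ?(ltW tx)// andbT.
    by apply/eqP => /esym fx0; move: tx; rewrite (f_root _ _ xI tI fx0 ft0) ltxx.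
have [[a aI fa_lt0]|f_ge0] := pselect (exists2 a, a \in `[L, U] & f a < 0).
  (* [U] itself would not do: the sign must be negative at [x = U] too. *)
  exists (U + 1) => [|x xI]; first exact: Or33.
  have xU : x < U + 1.
    by move: xI; rewrite in_itv/= => /andP[_ /le_lt_trans]; apply; rewrite ltrDl.
  rewrite !ltr0_sg ?subr_lt0//.
  case: (ltgtP (f x) 0) => // [fx_gt0|fx0]; last by case: noroot; exists x.
  (* By monotonicity a positive value can only occur to the right of [a], so the crossing hypothesis
     would produce a root. *)
  have ax : a < x.
    rewrite ltNge; apply/negP => /(f_homo _ _ xI aI)/(lt_le_trans fx_gt0).
    by rewrite ltNge (ltW fa_lt0).
  have [t tax ft0] := f_ivt _ _ aI xI ax fa_lt0 fx_gt0.
  case: noroot; exists t => //; move: tax aI xI; rewrite !in_itv/=.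
  move=> /andP[at_ tx] /andP[La _] /andP[_ xU'].
  by rewrite (le_trans La (ltW at_)) (le_trans (ltW tx) xU').
exists (L - 1) => [|x xI]; first exact: Or32.
have Lx : L - 1 < x.
  move: xI; rewrite in_itv/= => /andP[Lx _]; apply: lt_le_trans Lx.
  by rewrite ltrBlDr ltrDl.
rewrite !gtr0_sg ?subr_gt0//.
case: (ltgtP (f x) 0) => // [fx_lt0|fx0]; first by case: f_ge0; exists x.
by case: noroot; exists x.
Qed.

Theorem theoremS3 (R : realType) (Y : set R)
    (states : set (joint_distribution R))
    (u uExt : utility R) (L U : R) :
  (forall P, states P -> state_of_nature Y P) ->
  L < U ->
  bounded_means L U states ->
  is_extension Y L U u uExt ->
  decision_monotonicity L U uExt ->
  unique_crossing L U uExt ->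
  exists phi : bool -> R -> R,
    [/\ same_optimal_decision L U uExt (standard_utility phi),
        {in `[L, U], forall p, phi true p = p} &
        {in `[L, U] &, {homo phi false : p q / p <= q}}].
Proof.
move=> _ LU _ _ [homo1 homo0] crossing.
(* Membership in the interval is put under the existential so that [choice] yields a total function;
   the value 0 outside is arbitrary. *)
have /choice[phi0 phi0P] : forall p0, exists t, p0 \in `[L, U] ->
    [\/ t \in `[L, U], t = L - 1 | t = U + 1] /\
    {in `[L, U], forall p1, Num.sg (contrast uExt p0 p1) = Num.sg (p1 - t)}.
  move=> p0; have [p0I|_] := boolP (p0 \in `[L, U]); last by exists 0.
  have [f_root f_ivt] := crossing _ p0I.
  by have [t tI tP] := single_crossing_sg (homo1 _ p0I) f_root f_ivt; exists t.
exists (fun d => if d then id else phi0); split => //.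
  move=> p0 p1 p0I p1I; have [_ /(_ _ p1I) sgE] := phi0P _ p0I.
  rewrite /(contrast (standard_utility _)) /standard_utility/=.
  split; first by rewrite -sgr_gt0 sgE sgr_gt0.
  have c0E : (contrast uExt p0 p1 == 0) = (p1 - phi0 p0 == 0).
    by rewrite -sgr_eq0 sgE sgr_eq0.
  by split=> /eqP; [rewrite c0E | rewrite -c0E] => /eqP.
move=> p0 q0 p0I q0I pq; rewrite /= leNgt; apply/negP => phi_lt.
have [tpI sgp] := phi0P _ p0I; have [tqI sgq] := phi0P _ q0I.
have LI : L \in `[L, U] by rewrite in_itv/= lexx ltW.
(* Either threshold serves as [p1] if it lies in the interval. Otherwise [phi_lt] leaves only
   [L - 1] for [q0] and [U + 1] for [p0], with [L] in between. *)
have [p1 p1I /andP[qp1 p1p]] :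
    exists2 p1, p1 \in `[L, U] & phi0 q0 <= p1 <= phi0 p0.
  case: tqI => [tqI|tqE|tqE]; first by exists (phi0 q0); rewrite ?lexx ?ltW.
  - case: tpI => [tpI|tpE|tpE]; first by exists (phi0 p0); rewrite ?lexx ?ltW.
      by move: phi_lt; rewrite tqE tpE ltxx.
    by exists L => //; rewrite tqE tpE; lra.
  - case: tpI => [tpI|tpE|tpE]; first by exists (phi0 p0); rewrite ?lexx ?ltW.
      by move: phi_lt; rewrite tqE tpE; lra.
    by move: phi_lt; rewrite tqE tpE ltxx.
have cq : 0 <= contrast uExt q0 p1 by rewrite -sgr_ge0 sgq// sgr_ge0 subr_ge0.
have cp : contrast uExt p0 p1 <= 0 by rewrite -sgr_le0 sgp// sgr_le0 subr_le0.
have cqp := homo0 _ p1I _ _ q0I p0I pq.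
have /eqP : contrast uExt p0 p1 = 0 by apply/eqP; rewrite eq_le cp (le_trans cq).
rewrite -sgr_eq0 sgp// sgr_eq0 subr_eq0 => /eqP p1E.
have /eqP : contrast uExt q0 p1 = 0.
  by apply/eqP; rewrite eq_le cq (le_trans cqp).
rewrite -sgr_eq0 sgq// sgr_eq0 subr_eq0 => /eqP p1E'.
by move: phi_lt; rewrite -p1E -p1E' ltxx.
Qed.
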